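(* Let $E$ be a separable (real) Banach space, $\mu$ a centered Gaussian probability on $E$, and $\mathcal H\subset E$ the Reproducing Kernel Hilbert Space (RKHS) of $\mu$. Then there exists a separable Banach space $\widetilde E$ with $\mathcal H\subset\widetilde E\subset E$ (as linear subspaces) such that (a) $\mu(\widetilde E)=1$, and (b) the embeddings $\mathcal H\hookrightarrow\widetilde E$ and $\widetilde E\hookrightarrow E$ are compact.
   Context: $E'$ denotes the topological dual of $E$. Each $\xi\in E'$ is regarded as the random variable $x\mapsto\langle\xi,x\rangle$ on $(E,\mu)$, and $E'_\mu$ denotes the completion (closure) of $E'$ in $L^2(\mu)$. The RKHS $\mathcal H$ of $\mu$ is the space of vectors $h=\int_E x\,g(x)\,d\mu(x)\in E$, $g\in E'_\mu$, endowed with the scalar product $\langle h_1,h_2\rangle_{\mathcal H}=\int_E g_1g_2\,d\mu$ for $h_i=\int_E x\,g_i(x)\,d\mu(x)$; it is a Hilbert space isometric to $E'_\mu$. The space $\widetilde E$ carries its own Banach norm; the embeddings are the inclusion maps, and an embedding is compact if it maps bounded sets to relatively compact sets. *)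

(* Defs.v *)
From HB Require Import structures.
From mathcomp Require Import all_boot all_order all_algebra.
From mathcomp Require Import all_classical all_reals all_analysis.

Set Implicit Arguments.
Unset Strict Implicit.
Unset Printing Implicit Defensive.

Import Order.TTheory GRing.Theory Num.Theory.
Import numFieldNormedType.Exports.

Local Open Scope classical_set_scope.
Local Open Scope ring_scope.

Definition separable (T : topologicalType) : Prop :=
  exists2 D : set T, countable D & dense D.

Definition borel (T : ptopologicalType) := g_sigma_algebraType (@open T).

Definition dual (R : realType) (E : normedModType R) : set (E -> R) :=
  [set xi : E -> R | linear (xi : E -> R^o) /\ continuous (xi : E -> R^o)].

(* The library's [normal_prob 0 s] is only a Gaussian law for [s != 0]; a
   degenerate Gaussian variable, here of law [\d_0], must be allowed. *)
Definition centered_normal_law (R : realType) (s : R) :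
    set (measurableTypeR R) -> \bar R :=
  if s == 0 then \d_(0 : measurableTypeR R) else normal_prob 0 s.

Definition centered_gaussian (R : realType) (E : normedModType R)
    (mu : probability (borel E) R) : Prop :=
  forall xi : E -> R, dual xi -> exists s : R,
    forall A : set (measurableTypeR R), measurable A ->
      mu (xi @^-1` A) = centered_normal_law s A.

Section bochner.
Context d (T : measurableType d) (R : realType) (E : normedModType R).
Variable mu : probability T R.

Definition simple_fun (s : T -> E) : Prop :=
  measurable_fun setT (s : T -> borel E) /\ finite_set (range s).

Definition simple_integral (s : T -> E) : E :=
  \sum_(y \in range s) fine (mu (s @^-1` [set y])) *: y.

(* [f] is Bochner integrable with integral [h] *)
Definition is_bochner_integral (f : T -> E) (h : E) : Prop :=
  measurable_fun setT (f : T -> borel E) /\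
  exists s : nat -> T -> E,
    [/\ forall n, simple_fun (s n),
        (\int[mu]_x (`|f x - s n x|)%:E)%E @[n --> \oo] --> 0%E &
        simple_integral (s n) @[n --> \oo] --> h].

End bochner.

Section rkhs.
Context (R : realType) (E : normedModType R).
Variable mu : probability (borel E) R.

(* E'_mu, the closure of E' in L^2(mu) *)
Definition dual_L2_closure : set (E -> R) :=
  [set g : E -> R | (g : borel E -> R) \in Lfun mu 2%:E /\
    forall eps : R, 0 < eps -> exists2 xi : E -> R, dual xi &
      ('N[mu]_2%:E[EFin \o (fun x : borel E => (g x - xi x)%R)] < eps%:E)%E].

Definition rkhs_repr (h : E) : set (E -> R) :=
  [set g | dual_L2_closure g /\
           is_bochner_integral mu (fun x : borel E => g x *: (x : E)) h].

Definition rkhs : set E := [set h | exists g, rkhs_repr h g].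

(* [g] is determined by [h] up to mu-a.e. equality, so the scalar product does
   not depend on the choice made by [xget]. *)
Definition rkhs_dot (h1 h2 : E) : R :=
  \int[mu]_x
    (xget (cst 0) (rkhs_repr h1) x * xget (cst 0) (rkhs_repr h2) x).

Definition rkhs_norm (h : E) : R := Num.sqrt (rkhs_dot h h).

Definition rkhs_bounded (B : set E) : Prop :=
  B `<=` rkhs /\ exists M : R, forall h, B h -> rkhs_norm h <= M.

End rkhs.

(* A linear subspace of [E] carrying a Banach norm of its own: the subspace is
   the range of [bsub_incl], and its elements are identified with those of
   [bsub_sort] through this injection. *)
Record banach_subspace (R : realType) (E : normedModType R) := BanachSubspace {
  bsub_sort :> completeNormedModType R;
  bsub_incl : {linear bsub_sort -> E};
  bsub_incl_inj : injective bsub_incl }.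

Definition bsub_set (R : realType) (E : normedModType R)
    (F : banach_subspace E) : set E := range (@bsub_incl R E F).

(* For [B] contained in the subspace, the preimage of [B] is [B] itself viewed
   as a subset of the Banach space [F]. *)
Definition rkhs_embedding_compact (R : realType) (E : normedModType R)
    (mu : probability (borel E) R) (F : banach_subspace E) : Prop :=
  forall B : set E, rkhs_bounded mu B ->
    precompact (@bsub_incl R E F @^-1` B).

Definition bsub_embedding_compact (R : realType) (E : normedModType R)
    (F : banach_subspace E) : Prop :=
  forall B : set F, bounded_set B -> precompact (@bsub_incl R E F @` B).

(* Main.v *)
(* Let V_n be the span of the first n points of a dense sequence of E, and let
   q_n be the distance to V_n, a seminorm decreasing pointwise to 0. Along a
   subsequence m_k, mu(q_{m_k} > 4^-k) is smaller than 2^-(k+1) and than a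
   universal constant p > 0. The space is F = {x | 2^k q_{m_k}(x) --> 0} with
   norm |x| + sup_k 2^k q_{m_k}(x): Borel-Cantelli gives mu(F) = 1, and since
   the seminorms q_{m_k} vanish on V_n for large k, finite nets of bounded parts
   of the V_n approximate F, which gives both separability and compactness.
   For h = int x g(x) dmu in the RKHS, Hahn-Banach yields a functional xi <= q
   with q(h) = xi(h) = int xi g dmu. As xi is centred Gaussian, mu(q > t) < p
   forces its standard deviation to be at most t, so q(h) is at most
   t (3 + |h|_H^2); with q = q_{m_k} and t = 4^-k, the balls of the RKHS are
   totally bounded in F. *)

Require Import Defs.
From HB Require Import structures.
From mathcomp Require Import all_boot all_order all_algebra.
From mathcomp Require Import all_classical all_reals all_analysis.
Import Order.TTheory GRing.Theory Num.Theory.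
Import numFieldNormedType.Exports.
Local Open Scope classical_set_scope.
Local Open Scope ring_scope.
From mathcomp Require Import measurable_realfun ring lra.

Set Implicit Arguments.
Unset Strict Implicit.
Unset Printing Implicit Defensive.

(** * Seminorms and the Hahn-Banach theorem *)

Definition is_seminorm (R : realType) (E : lmodType R) (q : E -> R) : Prop :=
  (forall x y, q (x + y) <= q x + q y) /\
  (forall (a : R) x, q (a *: x) = `|a| * q x).

Section seminorm.
Context (R : realType) (E : lmodType R) (q : E -> R).
Hypothesis qS : is_seminorm q.

Lemma seminorm0 : q 0 = 0.
Proof. by have := qS.2 0 0; rewrite scale0r normr0 mul0r. Qed.

Lemma seminormN x : q (- x) = q x.
Proof. by rewrite -scaleN1r qS.2 normrN normr1 mul1r. Qed.

Lemma seminormB x y : q (x - y) = q (y - x).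
Proof. by rewrite -seminormN opprB. Qed.

Lemma seminorm_ge0 x : 0 <= q x.
Proof.
have := qS.1 x (- x); rewrite subrr seminorm0 seminormN => h.
by rewrite -(pmulrn_lge0 _ (isT : 0 < 2)%N) mulr2n.
Qed.

Lemma seminorm_leD x y : q x <= q (x - y) + q y.
Proof. by have := qS.1 (x - y) y; rewrite subrK. Qed.

End seminorm.

Section hahn_banach.
Context (R : realType) (E : lmodType R) (q : E -> R).
Hypothesis qS : is_seminorm q.

Local Notation graph := (set (E * R)).

(** Partial functionals are encoded by their graphs, so that Zorn's lemma applies to plain inclusion
    of sets and the union of a chain is again a candidate. *)
Let linear_graph (G : graph) :=
  forall (a : R) x r y s, G (x, r) -> G (y, s) -> G (a *: x + y, a * r + s).

Let dominated_graph (G : graph) := forall x r, G (x, r) -> r <= q x.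

(** The difference of two values at [x] is a value at 0, hence at most [q 0 = 0]: domination makes a
    linear graph single-valued. *)
Let dominated_graph_uniq (G : graph) x r s :
  linear_graph G -> dominated_graph G -> G (x, r) -> G (x, s) -> r = s.
Proof.
move=> Glin Gdom.
have le u v : G (x, u) -> G (x, v) -> u <= v.
  move=> Gu Gv; have /Gdom := Glin (- 1) _ _ _ _ Gv Gu.
  by rewrite scaleN1r addNr (seminorm0 qS) mulN1r addrC subr_le0.
by move=> Gr Gs; apply/eqP; rewrite eq_le !le.
Qed.

Let extend (G : graph) (y : E) (c : R) : graph :=
  [set z | exists x r t, G (x, r) /\ z = (x + t *: y, r + t * c)].

(** Subadditivity of [q] puts every [r - q (x - y)] below every [q (x' + y) - r'], for [(x, r)] and
    [(x', r')] in [G]; the supremum of the former is an admissible value at [y]. *)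
Let extend_value (G : graph) (y : E) : linear_graph G -> dominated_graph G ->
  G !=set0 -> exists c, dominated_graph (extend G y c).
Proof.
move=> Glin Gdom [[x0 r0] G0].
pose L := [set u : R | exists x r, G (x, r) /\ u = r - q (x - y)].
have Lub x r : G (x, r) -> ubound L (q (x + y) - r).
  move=> Gxr _ [x' [r' [G' ->]]].
  have := Gdom _ _ (Glin 1 _ _ _ _ Gxr G'); have := qS.1 (x + y) (x' - y).
  by rewrite addrACA subrr addr0 scale1r mul1r; lra.
have Lsup : has_sup L.
  split; first by exists (r0 - q (x0 - y)), x0, r0.
  by exists (q (x0 + y) - r0); exact: Lub.
have G00 : G (0, 0).
  have := Glin (- 1) _ _ _ _ G0 G0.
  by rewrite scaleN1r mulN1r !addNr.
have Gscale a x r : G (x, r) -> G (a *: x, a * r).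
  by move=> /(Glin a _ _ _ _)/(_ G00); rewrite !addr0.
exists (sup L) => _ _ [x [r [t [Gxr [-> ->]]]]].
have up x' r' : G (x', r') -> sup L <= q (x' + y) - r'.
  by move=> G'; apply: ge_sup; [exact: Lsup.1 | exact: Lub].
have low x' r' : G (x', r') -> r' - q (x' - y) <= sup L.
  by move=> G'; apply: ub_le_sup; [exact: Lsup.2 | exists x', r'].
have [t0|t0|->] := ltgtP t 0.
- have nt0 : 0 < - t by rewrite oppr_gt0.
  have := low _ _ (Gscale (- t)^-1 _ _ Gxr).
  have -> : (- t)^-1 *: x - y = (- t)^-1 *: (x + t *: y).
    by rewrite scalerDr scalerA invrN mulNr mulVf ?lt_eqF// scaleN1r.
  rewrite qS.2 gtr0_norm ?invr_gt0// -mulrBr mulrC ler_pdivrMr//; lra.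
- have := up _ _ (Gscale t^-1 _ _ Gxr).
  have -> : t^-1 *: x + y = t^-1 *: (x + t *: y).
    by rewrite scalerDr scalerA mulVf ?gt_eqF// scale1r.
  rewrite qS.2 gtr0_norm ?invr_gt0// -mulrBr mulrC ler_pdivlMr//; lra.
- by rewrite scale0r mul0r !addr0; exact: Gdom.
Qed.

Lemma hahn_banach_seminorm (h : E) : exists xi : E -> R,
  [/\ linear (xi : E -> R^o), forall x, xi x <= q x & xi h = q h].
Proof.
(* The premise [G !=set0] lets the empty graph, which is the union of the empty chain, satisfy
   [P]. *)
pose P (G : graph) :=
  [/\ linear_graph G, dominated_graph G & G !=set0 -> G (h, q h)].
have [|G [[Glin Gdom Gh] Gmax]] := @Zorn_bigcup _ P.
  move=> C CP Ctot; split.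
  - move=> a x r y s [X CX Xx] [Y CY Yy].
    have [XY|YX] := Ctot _ _ CX CY.
    + by exists Y => //; have [Ylin _ _] := CP _ CY; exact: Ylin (XY _ Xx) Yy.
    + by exists X => //; have [Xlin _ _] := CP _ CX; exact: Xlin Xx (YX _ Yy).
  - by move=> x r [X /CP[_ Xdom _]]; exact: Xdom.
  - by move=> [z [X CX Xz]]; exists X => //; have [_ _] := CP _ CX; apply; exists z.
(* If the maximal graph missed this point it would be empty, and the line through [(h, q h)] would
   properly extend it. *)
have {}Gh : G (h, q h).
  apply: contrapT => nGh.
  have G0 : G = set0.
    by apply/eqP/negPn/negP => /set0P /Gh.
  apply: (Gmax [set z | exists t : R, z = (t *: h, t * q h)]); last first.
    split.
    - move=> a x r y s [t [-> ->]] [t' [-> ->]]; exists (a * t + t').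
      by rewrite scalerA -scalerDl mulrA -mulrDl.
    - move=> x r [t [-> ->]]; rewrite qS.2 ler_wpM2r ?ler_norm//.
      exact: seminorm_ge0.
    - by move=> _; exists 1; rewrite scale1r mul1r.
  rewrite G0; rewrite properEneq; split; last exact: sub0set.
  apply/eqP => /esym/eqP; apply/negP/set0P.
  by exists (h, q h), 1; rewrite scale1r mul1r.
have G00 : G (0, 0).
  by have := Glin (- 1) _ _ _ _ Gh Gh; rewrite scaleN1r mulN1r !addNr.
have Gtot x : exists r, G (x, r).
  apply: contrapT => nGx.
  have [c cdom] := extend_value x Glin Gdom (ex_intro _ _ Gh).
  have Gext : G `<=` extend G x c.
    by move=> [y s] Gy; exists y, s, 0; rewrite scale0r mul0r !addr0.
  apply: (Gmax (extend G x c)); last first.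
    split => // [|_]; last exact: Gext.
    move=> a y r z s [y' [r' [t [G1 [-> ->]]]]] [z' [s' [t' [G2 [-> ->]]]]].
    exists (a *: y' + z'), (a * r' + s'), (a * t + t'); split; first exact: Glin.
    congr (_, _); last by ring.
    by rewrite scalerDr scalerDl addrACA scalerA.
  rewrite properEneq; split => //; apply/eqP => GE; apply: nGx; exists c.
  by rewrite GE; exists 0, 0, 1; rewrite scale1r mul1r !add0r.
have [xi xiG] := choice Gtot.
exists xi; split => [a x y|x|].
- apply: (dominated_graph_uniq Glin Gdom (xiG _)).
  exact: (Glin a _ _ _ _ (xiG x) (xiG y)).
- exact: Gdom.
- exact: (dominated_graph_uniq Glin Gdom (xiG _)).
Qed.

End hahn_banach.

(** * Distance to a span and finite nets *)

Section distance.
Context (R : realType) (E : normedModType R).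
Implicit Types (V W : set E) (x y v : E).

Definition linear_set V :=
  V 0 /\ forall (a : R) x y, V x -> V y -> V (a *: x + y).

Definition set_dist V x : R := inf [set `|x - v| | v in V].

Lemma set_dist_le V x v : V v -> set_dist V x <= `|x - v|.
Proof.
move=> Vv; apply: ge_inf; last by exists v.
by exists 0 => _ [w _ <-].
Qed.

Lemma le_set_dist V x (c : R) : V !=set0 ->
  (forall v, V v -> c <= `|x - v|) -> c <= set_dist V x.
Proof.
move=> [v Vv] h; apply: lb_le_inf; first by exists `|x - v|, v.
by move=> _ [w Vw <-]; exact: h.
Qed.

Lemma set_dist_lt V x (e : R) : V !=set0 -> set_dist V x < e ->
  exists2 v, V v & `|x - v| < e.
Proof.
move=> V0; apply: contraPP => nV; apply/negP; rewrite -leNgt.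
apply: le_set_dist => // v Vv; rewrite leNgt; apply/negP => xv.
by apply: nV; exists v.
Qed.

Lemma set_distS V W x : V !=set0 -> V `<=` W -> set_dist W x <= set_dist V x.
Proof. by move=> V0 VW; apply: le_set_dist => // v /VW; exact: set_dist_le. Qed.

Lemma set_dist_ge0 V x : V !=set0 -> 0 <= set_dist V x.
Proof. by move=> V0; exact: le_set_dist. Qed.

Lemma set_dist_mem V v : V v -> set_dist V v = 0.
Proof.
move=> Vv; apply/eqP; rewrite eq_le set_dist_ge0 ?andbT; last by exists v.
by rewrite (le_trans (set_dist_le _ Vv))// subrr normr0.
Qed.

Section linear_set.
Variables (V : set E) (Vlin : linear_set V).

Let V0 : V !=set0. Proof. by exists 0; case: Vlin. Qed.

Lemma set_dist_norm x : set_dist V x <= `|x|.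
Proof. by rewrite -{2}(subr0 x) set_dist_le//; case: Vlin. Qed.

Lemma set_dist_seminorm : is_seminorm (set_dist V).
Proof.
have [V00 VZD] := Vlin.
(* Applied to [a^-1] and [a *: x], this inequality also yields the converse one. *)
have leZ (a : R) x : set_dist V (a *: x) <= `|a| * set_dist V x.
  have [->|a0] := eqVneq a 0.
    by rewrite scale0r normr0 mul0r set_dist_mem.
  rewrite -ler_pdivrMl ?normr_gt0//; apply: le_set_dist => // v Vv.
  rewrite ler_pdivrMl ?normr_gt0// -normrZ scalerBr; apply: set_dist_le.
  by rewrite -[_ *: v]addr0; exact: VZD.
split=> [x y|a x].
  rewrite -lerBlDr; apply: le_set_dist => // v Vv.
  rewrite lerBlDr -lerBlDl; apply: le_set_dist => // w Vw.
  rewrite lerBlDl (le_trans (set_dist_le _ (VZD 1 _ _ Vv Vw)))//.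
  by rewrite scale1r opprD addrACA ler_normD.
apply/eqP; rewrite eq_le leZ/=.
have [->|a0] := eqVneq a 0.
  by rewrite scale0r normr0 mul0r set_dist_mem.
rewrite -ler_pdivlMl ?normr_gt0// -normfV.
by apply: le_trans (leZ _ _); rewrite scalerA mulVf// scale1r.
Qed.

End linear_set.

(** * Spans of the initial segments of a sequence *)

Section seq_span.
Variable d : nat -> E.

Fixpoint seq_span n : set E :=
  if n is m.+1 then
    [set x | exists w (t : R), seq_span m w /\ x = w + t *: d m]
  else [set 0].

Lemma seq_span_lin n : linear_set (seq_span n).
Proof.
elim: n => [|n [V0 VZD]] /=; split=> //.
- by move=> a _ _ -> ->; rewrite scaler0 addr0.
- by exists 0, 0; rewrite scale0r addr0.
- move=> a _ _ [w [t [Vw ->]]] [w' [t' [Vw' ->]]].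
  exists (a *: w + w'), (a * t + t'); split; first exact: VZD.
  by rewrite scalerDr scalerDl addrACA scalerA.
Qed.

Lemma seq_spanS m n : (m <= n)%N -> seq_span m `<=` seq_span n.
Proof.
elim: n => [|n IH]; first by rewrite leqn0 => /eqP ->.
rewrite leq_eqVlt => /predU1P[->//|/IH mn] x /mn Vx.
by exists x, 0; rewrite scale0r addr0.
Qed.

Lemma seq_span_mem n : seq_span n.+1 (d n).
Proof.
by exists 0, 1; rewrite scale1r add0r; split => //; case: (seq_span_lin n).
Qed.

Lemma interval_net (C e : R) : 0 < e -> exists2 A : set R, finite_set A &
  forall t, `|t| <= C -> exists2 s, A s & `|t - s| <= e.
Proof.
move=> e0; have [C0|C0] := ltP C 0.
  by exists set0 => // t tC; have := le_lt_trans tC C0; rewrite normr_lt0.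
pose N := (Num.truncn (2 * C / e)).+1.
exists [set k%:R * e - C | k in `I_N]; first exact/finite_image/finite_II.
move=> t; rewrite ler_norml => /andP[Ct tC].
pose k := Num.truncn ((t + C) / e).
have tC0 : 0 <= (t + C) / e by apply: divr_ge0; [lra | exact: ltW].
have /andP[k1 k2] := truncn_itv tC0.
exists (k%:R * e - C).
  exists k => //=; rewrite ltnS le_truncn// ler_pM2r ?invr_gt0//; lra.
rewrite ler_pdivlMr// in k1; rewrite ltr_pdivrMr// in k2.
rewrite -natr1 mulrDl mul1r in k2.
by rewrite ger0_norm; lra.
Qed.

(* When [d n] is at distance 0 from the preceding span, it is replaced by an
   element of that span; otherwise its coefficient in a bounded vector is
   bounded. *)
Lemma seq_span_net n (M e : R) : 0 < e ->
  exists A : set E, [/\ finite_set A, A `<=` seq_span n &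
    forall v, seq_span n v -> `|v| <= M -> exists2 a, A a & `|v - a| <= e].
Proof.
elim: n M e => [|n IH] M e e0.
  exists [set 0]; split => // _ -> _; exists 0 => //.
  by rewrite subrr normr0 ltW.
have [V0 VZD] := seq_span_lin n.
have V0' : seq_span n !=set0 by exists 0.
have e20 : 0 < e / 2 by rewrite divr_gt0.
have := set_dist_ge0 (d n) V0'; rewrite le_eqVlt => /predU1P[d0|d0].
  have [A [Afin AV Anet]] := IH (M + e / 2) _ e20.
  exists A; split => //; first exact: (subset_trans AV (seq_spanS (leqnSn n))).
  move=> _ [w [t [Vw ->]]] vM.
  have t1 : 0 < `|t| + 1 by rewrite ltr_pwDr.
  (* No bound on [t] is known here, so [u] is chosen after [t], close enough to [d n] for [t *: u]
     to be within [e / 2] of [t *: d n]; this is why the net covers norms up to [M + e / 2]. *)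
  have [|u Vu du] := @set_dist_lt (seq_span n) (d n) (e / 2 / (`|t| + 1)) V0'.
    by rewrite -d0 divr_gt0.
  have close : `|t *: d n - t *: u| <= e / 2.
    rewrite -scalerBr normrZ (@le_trans _ _ ((`|t| + 1) * `|d n - u|))//.
      by rewrite ler_wpM2r// lerDl.
    by rewrite mulrC -ler_pdivlMr// ltW.
  have decomp : w + t *: u = (w + t *: d n) - (t *: d n - t *: u).
    by rewrite opprB addrACA subrr addr0.
  have [||a Aa ha] := Anet (t *: u + w).
  - exact: VZD.
  - by rewrite addrC decomp (le_trans (ler_normB _ _))// lerD.
  exists a => //.
  have -> : w + t *: d n - a = (t *: d n - t *: u) + (t *: u + w - a).
    by rewrite !addrA subrK [t *: _ + w]addrC.
  by rewrite (le_trans (ler_normD _ _))// (splitr e) lerD.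
(* [|t| * set_dist (seq_span n) (d n)] is the distance of [t *: d n] to the span, which is at most
   [|w + t *: d n| <= M]; hence [|t| <= C]. *)
pose C := M / set_dist (seq_span n) (d n).
have dn1 : 0 < `|d n| + 1 by rewrite ltr_pwDr.
have [A [Afin AV Anet]] := IH (M + C * `|d n|) _ e20.
have [T Tfin Tnet] := @interval_net C (e / 2 / (`|d n| + 1)) (divr_gt0 e20 dn1).
exists [set a + t *: d n | a in A & t in T]; split.
- exact: finite_image2.
- by move=> _ [a /AV Va [t _ <-]]; exists a, t.
move=> _ [w [t [Vw ->]]] vM.
have tC : `|t| <= C.
  rewrite ler_pdivlMr//; apply: le_trans vM.
  have [dZ] := (set_dist_seminorm (seq_span_lin n)).
  move=> dS; rewrite -dS.
  have := set_dist_le (t *: d n) (VZD (-1) _ _ Vw V0).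
  by rewrite addr0 scaleN1r opprK addrC.
have [s Ts ts] := Tnet _ tC.
have [||a Aa wa] := Anet w => //.
  have -> : w = (w + t *: d n) - t *: d n by rewrite addrK.
  by rewrite (le_trans (ler_normB _ _))// normrZ lerD// ler_wpM2r.
exists (a + s *: d n); first by exists a => //; exists s.
rewrite opprD addrACA -scalerBl (le_trans (ler_normD _ _))// (splitr e) lerD//.
rewrite normrZ (@le_trans _ _ (`|t - s| * (`|d n| + 1)))//.
  by rewrite ler_wpM2l// lerDl.
by rewrite -ler_pdivlMr.
Qed.

Lemma seq_span_dist_small : dense (range d) -> forall x (e : R), 0 < e ->
  exists n, set_dist (seq_span n) x < e.
Proof.
move=> dd x e e0.
have [|y [xy [i _ dE]]] := dd _ _ (@ball_open _ _ x e).
  by exists x; exact: ballxx.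
exists i.+1; apply: le_lt_trans (set_dist_le _ (seq_span_mem i)) _.
by rewrite dE; move: xy; rewrite -ball_normE.
Qed.

End seq_span.
End distance.

(** * Spaces defined by vanishing sequences of seminorms *)

(** Otherwise the complements of all the [F i] belong to [U], and so does their finite intersection,
    which is disjoint from the union. *)
Lemma ultra_finite_bigcup (T : Type) (I : choiceType) (U : set_system T)
    (A : set I) (F : I -> set T) : UltraFilter U -> finite_set A ->
  U (\bigcup_(i in A) F i) -> exists2 i, A i & U (F i).
Proof.
move=> UU Afin UA; apply: contrapT => nA.
have UC i : A i -> U (~` F i).
  move=> Ai; have [UF|//] := in_ultra_setVsetC (F i) UU.
  by exfalso; apply: nA; exists i.
have : U (\bigcap_(i in A) ~` F i).
  have /finite_fsetP[D AD] := Afin.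
  by rewrite AD in UC *; apply: filter_bigI => i /UC.
rewrite -setC_bigcup => UCA; apply: (@filter_not_empty _ U).
by rewrite -(setICr (\bigcup_(i in A) F i)); exact: filterI.
Qed.

(** By completeness it suffices that every ultrafilter containing the closure of [B] is Cauchy, and
    such an ultrafilter contains one of the finitely many balls around a net. Half of [e] pays for
    passing from [B] to its closure. *)
Lemma precompact_net (R : realType) (E : completeNormedModType R) (B : set E) :
  (forall e : R, 0 < e -> exists2 A : set E, finite_set A &
     forall b, B b -> exists2 a, A a & `|b - a| < e) ->
  precompact B.
Proof.
move=> Bnet; rewrite precompactE compact_ultra => U UU UB.
have Ucvg : cvg U.
  apply: cauchy_cvg; apply/cauchyP => e e0.
  have [A Afin Anet] := Bnet (e / 2) (divr_gt0 e0 (ltr0Sn _ 1)).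
  have [|a _ Ua] := @ultra_finite_bigcup _ _ U A (fun a => ball a e) UU Afin;
    last by exists a.
  apply: filterS UB => x Bx.
  have [y [By xy]] := Bx _ (nbhsx_ballx x (e / 2) (divr_gt0 e0 (ltr0Sn _ 1))).
  have [a Aa ya] := Anet y By; exists a => //.
  move: xy; rewrite -!ball_normE /= => xy.
  by rewrite distrC (splitr e) (le_lt_trans (ler_distD y _ _))// ltrD.
exists (lim U); split; last exact: Ucvg.
exact: (@closed_cvg _ _ U _ id (closure B) (@closed_closure _ B)).
Qed.

(** [sseq_bounded] is the continuity of each seminorm, with a constant that may depend on [k]; it
    lets estimates on the seminorms pass to limits taken in [E]. *)
Record seminorm_seq (R : realType) (E : normedModType R) := SeminormSeq {
  sseq :> nat -> E -> R ;
  sseq_seminorm : forall k, is_seminorm (sseq k) ;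
  sseq_bounded : forall k, exists C, forall x, sseq k x <= C * `|x| }.

Section vanishing_space.
Context (R : realType) (E : completeNormedModType R) (r : seminorm_seq E).

(* An analogue of c_0: requiring [r k x] to tend to 0, and not only to be
   bounded in [k], is what will make the space separable. *)
Definition vanishing : {pred E} :=
  fun x => `[< forall e : R, 0 < e ->
    exists n, forall k, (n <= k)%N -> r k x <= e >].

Lemma vanishingP x : reflect (forall e : R, 0 < e ->
    exists n, forall k, (n <= k)%N -> r k x <= e) (x \in vanishing).
Proof. exact: asboolP. Qed.

Fact vanishing_submod : submod_closed vanishing.
Proof.
split=> [|a x y /vanishingP xv /vanishingP yv]; apply/vanishingP => e e0.
  by exists 0 => k _; rewrite (seminorm0 (sseq_seminorm r k)) ltW.
have a1 : 0 < `|a| + 1 by rewrite ltr_pwDr.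
have [m hm] := xv (e / 2 / (`|a| + 1)) (divr_gt0 (divr_gt0 e0 (ltr0Sn _ 1)) a1).
have [n hn] := yv (e / 2) (divr_gt0 e0 (ltr0Sn _ 1)).
exists (maxn m n) => k; rewrite geq_max => /andP[/hm mk /hn nk].
have [rD rZ] := sseq_seminorm r k.
rewrite (le_trans (rD _ _))// (splitr e) lerD// rZ.
rewrite ler_pdivlMr// mulrC in mk; apply: le_trans mk.
by rewrite ler_wpM2r ?lerDl// (seminorm_ge0 (sseq_seminorm r k)).
Qed.

HB.instance Definition _ := GRing.isSubmodClosed.Build R E vanishing
  vanishing_submod.

Record vanishing_space :=
  Vanishing { vanishing_val : E ; _ : vanishing_val \in vanishing }.

HB.instance Definition _ := [isSub for vanishing_val].
HB.instance Definition _ := [Choice of vanishing_space by <:].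
HB.instance Definition _ := [SubChoice_isSubLmodule of vanishing_space by <:].

Implicit Types x y : vanishing_space.

Lemma vanishing_valP x : vanishing_val x \in vanishing.
Proof. exact: valP. Qed.

Lemma vanishing_valB x y :
  vanishing_val (x - y) = vanishing_val x - vanishing_val y.
Proof. by []. Qed.

Lemma vanishing_has_sup x : has_sup (range (fun k => r k (vanishing_val x))).
Proof.
split; first by exists (r 0 (vanishing_val x)), 0%N.
have /vanishingP/(_ 1 ltr01)[n hn] := vanishing_valP x.
exists (Num.max 1 (\big[Num.max/0]_(i < n) r i (vanishing_val x))) => _ [k _ <-].
rewrite le_max; have [/hn->//|kn] := leqP n k.
by apply/orP; right; rewrite (le_bigmax _ (fun i : 'I_n => r i _) (Ordinal kn)).
Qed.

Definition vanishing_norm x : R :=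
  `|vanishing_val x| + sup (range (fun k => r k (vanishing_val x))).

Lemma vanishing_norm_le x (c d : R) : `|vanishing_val x| <= c ->
  (forall k, r k (vanishing_val x) <= d) -> vanishing_norm x <= c + d.
Proof.
move=> xc rd; rewrite lerD//; apply: ge_sup; first exact: (vanishing_has_sup x).1.
by move=> _ [k _ <-].
Qed.

Lemma le_vanishing_norm x k :
  `|vanishing_val x| + r k (vanishing_val x) <= vanishing_norm x.
Proof.
by rewrite lerD2l; apply: (ub_le_sup (vanishing_has_sup x).2); exists k.
Qed.

Lemma le_norm_vanishing x : `|vanishing_val x| <= vanishing_norm x.
Proof.
apply: le_trans (le_vanishing_norm x 0); rewrite lerDl.
exact: (seminorm_ge0 (sseq_seminorm r 0)).
Qed.

Lemma le_sseq_vanishing x k : r k (vanishing_val x) <= vanishing_norm x.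
Proof. by apply: le_trans (le_vanishing_norm x k); rewrite lerDr. Qed.

Lemma sup_sseq_le x k :
  r k (vanishing_val x) <= sup (range (fun k => r k (vanishing_val x))).
Proof. by apply: (ub_le_sup (vanishing_has_sup x).2); exists k. Qed.

Lemma vanishing_normD x y :
  vanishing_norm (x + y) <= vanishing_norm x + vanishing_norm y.
Proof.
rewrite {2 3}/vanishing_norm addrACA; apply: vanishing_norm_le => [|k].
  exact: ler_normD.
by rewrite (le_trans ((sseq_seminorm r k).1 _ _))// lerD// sup_sseq_le.
Qed.

Lemma vanishing_normZ (a : R) x :
  vanishing_norm (a *: x) = `|a| * vanishing_norm x.
Proof.
have le b y : vanishing_norm (b *: y) <= `|b| * vanishing_norm y.
  rewrite mulrDr; apply: vanishing_norm_le => [|k]; first by rewrite normrZ.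
  by rewrite (sseq_seminorm r k).2 ler_wpM2l// sup_sseq_le.
apply/eqP; rewrite eq_le le/=; have [->|a0] := eqVneq a 0.
  by rewrite normr0 mul0r (le_trans _ (le_norm_vanishing _)).
rewrite -ler_pdivlMl ?normr_gt0// -normfV.
by apply: le_trans (le _ _); rewrite scalerA mulVf// scale1r.
Qed.

Lemma vanishing_norm_eq0 x : vanishing_norm x = 0 -> x = 0.
Proof.
move=> x0; apply/val_inj/eqP; rewrite -normr_le0 -x0.
exact: le_norm_vanishing.
Qed.

HB.instance Definition _ := Lmodule_isNormed.Build R vanishing_space
  vanishing_normD vanishing_normZ vanishing_norm_eq0.

(** A Cauchy filter converges in [E], to [u] say. The estimates on the seminorms pass to this limit
    uniformly in [k], so [u] lies in the space and is also the limit for its norm. *)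
Lemma vanishing_complete (F : set_system vanishing_space) :
  ProperFilter F -> cauchy F -> cvg F.
Proof.
move=> FF Fc.
pose G : set_system E := vanishing_val @ F.
have Gcvg : cvg G.
  apply: cauchy_cvg; apply/cauchyP => e e0.
  move/cauchyP: Fc => /(_ e e0)[x Fx].
  exists (vanishing_val x).
  change (F (vanishing_val @^-1` ball (vanishing_val x) e)).
  apply: filterS Fx => y; rewrite /= -!ball_normE /=; apply: le_lt_trans.
  by rewrite -vanishing_valB le_norm_vanishing.
pose u := lim G.
have near_u (e : R) (y : vanishing_space) : 0 < e -> F (ball y e) ->
    `|vanishing_val y - u| <= e /\ forall k, r k (vanishing_val y - u) <= e.
  move=> e0 Fy.
  have approx (d : R) : 0 < d ->
      exists z : vanishing_space, `|y - z| < e /\ `|vanishing_val z - u| < d.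
    move=> d0; have : F (vanishing_val @^-1` ball u d).
      by apply: Gcvg; exact: nbhsx_ballx.
    move=> /(filterI Fy)/filter_ex[z [yz zu]]; exists z.
    by move: yz zu; rewrite -!ball_normE /= distrC [`|u - _|]distrC distrC.
  split=> [|k]; apply/ler_addgt0Pr => d d0.
    have [z [yz zu]] := approx d d0.
    rewrite (le_trans (ler_distD (vanishing_val z) _ _))// lerD ?(ltW zu)//.
    by rewrite -vanishing_valB (le_trans (le_norm_vanishing _))// ltW.
  have [C hC] := sseq_bounded r k.
  have C1 : 0 < `|C| + 1 by rewrite ltr_pwDr.
  have [z [yz zu]] := approx (d / (`|C| + 1)) (divr_gt0 d0 C1).
  have -> : vanishing_val y - u = vanishing_val (y - z) + (vanishing_val z - u).
    by rewrite -[vanishing_val (y - z)]/(vanishing_val y - _) addrA subrK.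
  rewrite (le_trans ((sseq_seminorm r k).1 _ _))// lerD//.
    by rewrite (le_trans (le_sseq_vanishing _ _))// ltW.
  rewrite ltr_pdivlMr// in zu; apply: le_trans (ltW zu).
  rewrite (le_trans (hC _))// mulrC ler_wpM2l//.
  by rewrite (le_trans (ler_norm C))// lerDl.
have uv : u \in vanishing.
  apply/vanishingP => e e0; have e20 : 0 < e / 2 by rewrite divr_gt0.
  move/cauchyP: (Fc) => /(_ _ e20)[y Fy].
  have [_ yu] := near_u _ _ e20 Fy.
  have /vanishingP/(_ _ e20)[n hn] := vanishing_valP y.
  exists n => k /hn yk.
  have := seminorm_leD (sseq_seminorm r k) u (vanishing_val y).
  rewrite (seminormB (sseq_seminorm r k)) => /le_trans; apply.
  by rewrite (splitr e) lerD.
apply/cvg_ex; exists (Vanishing uv); apply/cvgrPdist_le => e e0.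
(* The norm of the space adds two terms, each at most [e / 4] at [y - u]; together with [z - y] this
   makes at most [3 * e / 4]. *)
have e40 : 0 < e / 4 by rewrite divr_gt0.
move/cauchyP: (Fc) => /(_ _ e40)[y Fy].
have [yu1 yu2] := near_u _ _ e40 Fy.
apply: filterS Fy => z; rewrite -ball_normE /= => yz.
rewrite (le_trans (ler_distD y _ _))//.
have : `|Vanishing uv - y| <= e / 4 + e / 4.
  by rewrite distrC; apply: vanishing_norm_le => [|k]; rewrite vanishing_valB.
move: yz; rewrite distrC; lra.
Qed.

HB.instance Definition _ :=
  Uniform_isComplete.Build vanishing_space vanishing_complete.

Lemma vanishing_val_linear : linear vanishing_val.
Proof. by []. Qed.

HB.instance Definition _ := GRing.isLinear.Build R vanishing_space E _
  vanishing_val vanishing_val_linear.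

Definition vanishing_subspace : banach_subspace E :=
  @BanachSubspace R E vanishing_space vanishing_val val_inj.

Lemma vanishing_subspaceE :
  bsub_set vanishing_subspace = [set x | x \in vanishing].
Proof.
apply/seteqP; split => [_ [x _ <-]|x xv /=]; first exact: valP.
by exists (Vanishing xv).
Qed.

End vanishing_space.

(** * The space given by weighted distances to nested spans *)

Section dist_seq.
Context (R : realType) (E : completeNormedModType R).
Variables (d : nat -> E) (m : nat -> nat).

Let dist k := set_dist (seq_span d (m k)).

Let dist_seminorm k : is_seminorm (dist k).
Proof. exact: set_dist_seminorm (seq_span_lin d (m k)). Qed.

Let dist_le_norm k x : dist k x <= `|x|.
Proof. exact: set_dist_norm (seq_span_lin d (m k)) x. Qed.

Let span_neq0 k : seq_span d (m k) !=set0.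
Proof. by exists 0; case: (seq_span_lin d (m k)). Qed.

Fact dist_seq_seminorm k : is_seminorm (fun x => 2 ^+ k * dist k x).
Proof.
have [dD dZ] := dist_seminorm k; split=> [x y|a x].
  by rewrite -mulrDr ler_wpM2l// exprn_ge0.
by rewrite dZ mulrCA.
Qed.

Fact dist_seq_bounded k : exists C, forall x, 2 ^+ k * dist k x <= C * `|x|.
Proof. by exists (2 ^+ k) => x; rewrite ler_wpM2l// exprn_ge0. Qed.

(* The weights [2 ^+ k] make the unit ball of the associated space totally
   bounded in [E], since it lies within [2 ^- k] of the [k]-th span. *)
Definition dist_seq := SeminormSeq dist_seq_seminorm dist_seq_bounded.

Local Notation F := (vanishing_space dist_seq).
Local Notation val := (@vanishing_val R E dist_seq).

Hypothesis m_homo : {homo m : i j / (i <= j)%N}.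

Let dist_span k j v : (k <= j)%N -> seq_span d (m k) v -> dist_seq j v = 0.
Proof.
move=> /m_homo kj /(seq_spanS kj) vj.
by rewrite /dist_seq /= /dist set_dist_mem ?mulr0.
Qed.

Let span_vanishing k v : seq_span d (m k) v -> v \in vanishing dist_seq.
Proof.
move=> vk; apply/vanishingP => e e0; exists k => j kj.
by rewrite (dist_span kj)// ltW.
Qed.

(** A net of the [k]-th span with precision [e / 2 ^+ k] in [E] is also a net in [F]: indices
    [j < k] have weight at most [2 ^+ k], and for [j >= k] the seminorm vanishes on the net and is
    at most [e] at [h]. The factor 6 is 3 for the norm of [E] plus 3 for the supremum. *)
Lemma dist_seq_net k (M e : R) : 0 < e ->
  exists2 A : set F, finite_set A &
    forall h : F, `|val h| <= M ->
      (forall j, (k <= j)%N -> dist_seq j (val h) <= e) ->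
      exists2 a, A a & `|h - a| <= 6 * e.
Proof.
move=> e0.
have k0 : 0 < 2 ^+ k :> R by rewrite exprn_gt0.
have k1 : 1 <= 2 ^+ k :> R by rewrite exprn_ege1// ler1n.
have ek0 : 0 < e / 2 ^+ k by rewrite divr_gt0.
have ek1 : e / 2 ^+ k <= e by rewrite ler_pdivrMr// ler_peMr// ltW.
have [A [Afin AV Anet]] := seq_span_net d (m k) (M + 2 * e) ek0.
exists (val @^-1` A).
  by apply: finite_preimage => // x y _ _; exact: val_inj.
move=> h hM hk.
(* The infimum defining the distance may not be attained, whence the factor 2. *)
have [|v Vv hv] := @set_dist_lt _ _ _ (val h) (2 * (e / 2 ^+ k)) (span_neq0 k).
  apply: (@le_lt_trans _ _ (e / 2 ^+ k)); last by lra.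
  by rewrite ler_pdivlMr// mulrC; exact: hk.
have [||a Aa va] := Anet v => //.
  have := ler_distD (val h) v 0; rewrite !subr0 distrC; lra.
have ha : `|val h - a| <= 3 * (e / 2 ^+ k).
  have := ler_distD v (val h) a; lra.
have Va := AV _ Aa; have av := span_vanishing Va.
exists (Vanishing av) => //.
have -> : 6 * e = 3 * e + 3 * e by lra.
apply: vanishing_norm_le; rewrite vanishing_valB/=; first by lra.
move=> j; have [kj|jk] := leqP k j.
  have [rD _] := dist_seq_seminorm j.
  rewrite (le_trans (rD _ _))// (seminormN (dist_seq_seminorm j)).
  have /= -> := dist_span kj Va; have /= := hk _ kj; lra.
apply: (@le_trans _ _ (2 ^+ k * (3 * (e / 2 ^+ k)))).
  rewrite ler_pM ?exprn_ge0 ?(seminorm_ge0 (dist_seminorm j))//.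
    by rewrite ler_eXn2l ?ltr1n// ltnW.
  exact: le_trans (dist_le_norm _ _) ha.
by rewrite mulrCA [2 ^+ k * _]mulrC divfK ?gt_eqF.
Qed.

(** At each precision, every vector of [F] meets the conditions of [dist_seq_net] for some [k] and
    some integer [M], so countably many finite nets form a dense set. *)
Lemma dist_seq_separable : separable F.
Proof.
(* The triple [z] is [(k, M, n)]: starting index, bound on the norm, precision. *)
have /choice[A AP] : forall z : nat * nat * nat, exists A : set F,
    finite_set A /\ forall h : F, `|val h| <= z.1.2%:R ->
      (forall j, (z.1.1 <= j)%N -> dist_seq j (val h) <= z.2.+1%:R^-1) ->
      exists2 a, A a & `|h - a| <= 6 / z.2.+1%:R.
  move=> [[k M] n]; have [|A Afin Anet] := @dist_seq_net k M%:R (n.+1%:R^-1).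
    by rewrite invr_gt0.
  by exists A.
exists (\bigcup_(z in setT) A z).
  by apply: bigcup_countable => // z _; apply: finite_set_countable; case: (AP z).
move=> O [h Oh] oO.
have [e /= e0 he] : exists2 e : R, 0 < e & ball h e `<=` O.
  by apply/nbhs_ballP; exact: open_nbhs_nbhs.
pose n := Num.truncn (6 / e).
have n0 : 0 < n.+1%:R^-1 :> R by rewrite invr_gt0.
have ne : 6 / n.+1%:R < e.
  by rewrite ltr_pdivrMr// mulrC -ltr_pdivrMr// truncnS_gt.
have /vanishingP/(_ _ n0)[k hk] := vanishing_valP h.
pose M := (Num.truncn `|val h|).+1.
have hM : `|val h| <= M%:R by rewrite ltW// truncnS_gt.
have [_ /(_ h hM hk)[a Aa ha]] := AP (k, M, n).
exists a; split; last by exists (k, M, n).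
by apply: he; rewrite -ball_normE /=; exact: le_lt_trans ha ne.
Qed.

(** The counterpart of the criterion for relative compactness in c_0: boundedness together with
    uniformly small tails. *)
Lemma dist_seq_precompact (B : set F) (M : R) :
  (forall h, B h -> `|val h| <= M) ->
  (forall e : R, 0 < e -> exists k, forall h, B h -> forall j, (k <= j)%N ->
    dist_seq j (val h) <= e) ->
  precompact B.
Proof.
move=> BM Bv; apply: precompact_net => e e0.
have e70 : 0 < e / 7 by rewrite divr_gt0.
have [k hk] := Bv _ e70; have [A Afin Anet] := dist_seq_net k M e70.
exists A => // h Bh; have [a Aa ha] := Anet h (BM _ Bh) (hk _ Bh).
by exists a => //; apply: le_lt_trans ha _; lra.
Qed.

Lemma dist_seq_embedding_compact :
  bsub_embedding_compact (vanishing_subspace dist_seq).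
Proof.
(* [bounded_set] provides as bounds only the numbers strictly above [M0], hence [M0 + 1]. *)
move=> B [M0 [_ /(_ (M0 + 1))]]; set M := M0 + 1.
rewrite ltrDl => /(_ ltr01) hM; apply: precompact_net => e e0.
have e20 : 0 < e / 2 by rewrite divr_gt0.
(* For this [k], the bound [2 ^+ k * dist k (val h) <= M] on [B] places [B] within [e / 2] of the
   [k]-th span. *)
pose k := Num.truncn (M / (e / 2)).
have Mk : M < 2 ^+ k * (e / 2).
  rewrite -ltr_pdivrMr//; apply: lt_le_trans (truncnS_gt _) _.
  by rewrite -natrX ler_nat; exact: ltn_expl.
have [A [Afin AV Anet]] :=
  seq_span_net d (m k) (M + e / 2) (divr_gt0 e20 (ltr0Sn _ 1)).
exists A => // _ [h Bh <-].
have hE : `|val h| <= M.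
  by apply: le_trans (hM _ Bh); exact: (@le_norm_vanishing R E dist_seq h).
have hk : 2 ^+ k * dist k (val h) <= M.
  by apply: le_trans (hM _ Bh); exact: (@le_sseq_vanishing R E dist_seq h k).
have [|v Vv hv] := @set_dist_lt _ _ _ (val h) (e / 2) (span_neq0 k).
  by rewrite -(ltr_pM2l (exprn_gt0 k (ltr0Sn R 1))); exact: le_lt_trans hk Mk.
have [||a Aa va] := Anet v => //.
  have := ler_distD (val h) v 0; rewrite !subr0 distrC; lra.
exists a => //=; have := ler_distD v (val h) a; lra.
Qed.

End dist_seq.

(** * Gaussian tails and second moments *)

Lemma continuous_borel_measurable (R : realType) (T : ptopologicalType)
    (f : T -> R) : continuous f -> measurable_fun setT (f : borel T -> R).
Proof.
move=> cf; apply: (measurability _ (RGenOInfty.measurableE R)).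
move=> _ [_ [x ->] <-]; rewrite setTI; apply: sub_sigma_algebra.
have -> : f @^-1` `]x, +oo[%classic = f @^-1` [set y | x < y].
  by apply/seteqP; split => y /=; rewrite in_itv /= andbT.
by apply: open_comp => [y _|]; [exact: cf | exact: open_gt].
Qed.

Lemma measurable_gt d (T : measurableType d) (R : realType) (f : T -> R)
    (t : R) :
  measurable_fun setT f -> measurable [set x | t < f x].
Proof.
move=> mf.
have -> : [set x | t < f x] = setT `&` f @^-1` `]t, +oo[%classic.
  by rewrite setTI; apply/seteqP; split => x /=; rewrite in_itv /= andbT.
exact: mf.
Qed.

Section normal_second_moment.
Context (R : realType).
Local Notation lebesgue := (@lebesgue_measure R).

(** The density [normal_pdf] and the Radon-Nikodym derivative have the same integral over every
    measurable set, hence agree almost everywhere. *)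
Lemma ge0_integral_normal_prob (m s : R) (f : R -> \bar R) :
  (forall x, (0 <= f x)%E) -> measurable_fun setT f ->
  (\int[normal_prob m s]_x f x =
   \int[lebesgue]_x (f x * (normal_pdf m s x)%:E))%E.
Proof.
move=> f0 mf; have dom := normal_prob_dominates m s.
rewrite -(Radon_Nikodym_SigmaFinite.change_of_variables dom f0)//.
have mpdf : measurable_fun setT (EFin \o normal_pdf m s).
  by apply/measurable_EFinP; exact: measurable_normal_pdf.
have iRN := Radon_Nikodym_SigmaFinite.f_integrable dom.
apply: ae_eq_integral => //.
- by apply: emeasurable_funM; [|exact: measurable_int iRN].
- by apply: emeasurable_funM.
- apply: ae_eqe_mul2l; apply: integral_ae_eq => // A _ mA.
  by rewrite -Radon_Nikodym_SigmaFinite.f_integral.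
Qed.

Lemma normal_peakE (s : R) : normal_peak s = (`|s| * Num.sqrt (pi *+ 2))^-1.
Proof.
by rewrite /normal_peak -mulrnAr sqrtrM ?sqr_ge0// sqrtr_sqr.
Qed.

(** The ratio of the two densities is [2 * expR (- u)] with [u = 3 * x ^+ 2 / (8 * s ^+ 2)], and
    [u * expR (- u) <= 1]. The quadratic factor is thus absorbed into a wider Gaussian density,
    whose total mass is 1. *)
Lemma sqr_normal_pdf_le (s x : R) : s != 0 ->
  x ^+ 2 * normal_pdf 0 s x <= 6 * s ^+ 2 * normal_pdf 0 (2 * s) x.
Proof.
move=> s0; rewrite !normal_pdfE// ?mulf_neq0// !normal_peakE normrM.
rewrite /normal_fun !subr0 (ger0_norm (ler0n _ 2)) exprMn.
set c := Num.sqrt (pi *+ 2).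
have v0 : 0 < s ^+ 2 by rewrite exprn_even_gt0.
set v := s ^+ 2 in v0 *; set y := x ^+ 2.
pose u := 3 * y / (8 * v).
have -> : - y / (v *+ 2) = - y / (2 ^+ 2 * v *+ 2) + (- u).
  by rewrite /u; field; rewrite gt_eqF.
rewrite expRD; set w := expR (- y / _).
have w0 : 0 <= w by exact: expR_ge0.
have yu : y * expR (- u) <= 8 / 3 * v.
  have -> : y = 8 / 3 * v * u by rewrite /u; field; rewrite gt_eqF.
  rewrite -[leLHS]mulrA; apply: ler_piMr; first by lra.
  rewrite expRN ler_pdivrMr ?expR_gt0// mul1r.
  by apply: le_trans (expR_ge1Dx u); rewrite lerDr.
rewrite -[2 * _ * c]mulrA [(2 * _)^-1]invfM; set z := (`|s| * c)^-1.
have z0 : 0 <= z by rewrite invr_ge0 mulr_ge0// sqrtr_ge0.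
have zw0 : 0 <= z * w by rewrite mulr_ge0.
have -> : y * (z * (w * expR (- u))) = z * w * (y * expR (- u)) by ring.
have -> : 6 * v * (2^-1 * z * w) = z * w * (3 * v) by field.
by rewrite ler_wpM2l// (le_trans yu)// ler_wpM2r ?(ltW v0)//; lra.
Qed.

Lemma normal_prob_second_moment (s : R) : s != 0 ->
  (\int[normal_prob 0 s]_x (x ^+ 2)%:E <= (6 * s ^+ 2)%:E)%E.
Proof.
move=> s0; have s20 : 2 * s != 0 by rewrite mulf_neq0.
have msq : measurable_fun [set: R] (fun x : R => (x ^+ 2)%:E).
  by apply/measurable_EFinP; exact: measurable_funX.
rewrite ge0_integral_normal_prob//; last by move=> x; rewrite lee_fin sqr_ge0.
have mpdf t : measurable_fun [set: R] (fun x => (normal_pdf 0 t x)%:E).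
  by apply/measurable_EFinP; exact: measurable_normal_pdf.
apply: (@le_trans _ _
    (\int[lebesgue]_x ((6 * s ^+ 2)%:E * (normal_pdf 0 (2 * s) x)%:E)))%E.
  apply: ge0_le_integral => //=.
  - by move=> x _; rewrite mule_ge0// lee_fin ?sqr_ge0 ?normal_pdf_ge0.
  - by apply: emeasurable_funM; [exact: msq | exact: mpdf].
  - by apply: emeasurable_funM; [exact: measurable_cst | exact: mpdf].
  by move=> x _; rewrite -!EFinM lee_fin; exact: sqr_normal_pdf_le.
rewrite ge0_integralZl//.
- by rewrite integral_normal_pdf mule1.
- exact: mpdf.
- by move=> x _; rewrite lee_fin normal_pdf_ge0.
- by rewrite lee_fin mulr_ge0// sqr_ge0.
Qed.

(* On [[s, 2 s]], of length [s], the density of the law N(0, s^2) is at least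
   [normal_tail / s]. *)
Definition normal_tail : R := expR (- 2) / Num.sqrt (pi *+ 2).

Lemma normal_tail_gt0 : 0 < normal_tail.
Proof. by rewrite divr_gt0 ?expR_gt0// sqrtr_gt0 pmulrn_lgt0// pi_gt0. Qed.

(** The lower bound is the same for all [s]: this scale invariance lets a small tail control the
    standard deviation. *)
Lemma normal_prob_tail (s t : R) : s != 0 -> t < `|s| ->
  (normal_tail%:E <= normal_prob 0 s [set y | (t < `|y|)%R])%E.
Proof.
move=> s0 ts; have s1 : 0 < `|s| by rewrite normr_gt0.
have mA : measurable [set y : R | t < `|y|].
  by apply: measurable_gt; exact: normr_measurable.
have mI : measurable (`[`|s|, 2 * `|s|]%classic : set R) by [].
have mpdf D : measurable_fun D (fun x => (normal_pdf 0 s x)%:E).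
  by apply/measurable_EFinP/measurable_funTS; exact: measurable_normal_pdf.
have : (\int[lebesgue]_(x in `[(`|s|)%R, (2 * `|s|)%R]%classic)
      (normal_pdf 0 s x)%:E
    <= normal_prob 0 s [set y | (t < `|y|)%R])%E.
  apply: ge0_subset_integral => //; first exact: mpdf.
    by move=> x _; rewrite lee_fin normal_pdf_ge0.
  move=> x /=; rewrite in_itv /= => /andP[sx _].
  by rewrite (lt_le_trans ts)// (le_trans sx)// ler_norm.
move=> /(le_trans _); apply.
apply: (@le_trans _ _ (\int[lebesgue]_(x in `[(`|s|)%R, (2 * `|s|)%R]%classic)
   (cst (normal_peak s * expR (- 2))%:E) x)%E).
  rewrite integral_cst//= lebesgue_measure_itv/= lte_fin.
  have -> : `|s| < 2 * `|s| by lra.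
  rewrite -EFinD -EFinM lee_fin normal_peakE /normal_tail.
  have c0 : Num.sqrt (pi *+ 2) != 0 :> R.
    by rewrite gt_eqF// sqrtr_gt0 pmulrn_lgt0// pi_gt0.
  by rewrite le_eqVlt; apply/orP; left; apply/eqP; field; rewrite c0 gt_eqF.
apply: ge0_le_integral => //=.
- by move=> x _; rewrite lee_fin mulr_ge0 ?normal_peak_ge0 ?expR_ge0.
- exact: mpdf.
move=> x; rewrite in_itv /= => /andP[sx xs].
rewrite lee_fin normal_pdfE// /normal_fun subr0 ler_wpM2l ?normal_peak_ge0//.
rewrite ler_expR mulNr lerN2 ler_pdivrMr; last first.
  by rewrite pmulrn_lgt0// exprn_even_gt0.
have -> : 2 * (s ^+ 2 *+ 2) = (2 * `|s|) ^+ 2.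
  by rewrite exprMn real_normK ?num_real//; ring.
by rewrite ler_sqr// nnegrE; [exact: le_trans sx|rewrite mulr_ge0].
Qed.

(** By [normal_prob_tail], a standard deviation larger than [t] would give the tail beyond [t] a
    mass of at least [normal_tail]; so [|s| <= t]. The Dirac law is treated apart. *)
Lemma centered_gaussian_second_moment (E : normedModType R)
    (mu : probability (borel E) R) (xi : E -> R) (t : R) :
  centered_gaussian mu -> dual xi -> 0 <= t ->
  (mu [set x | (t < `|xi x|)%R] < normal_tail%:E)%E ->
  (\int[mu]_x (xi x ^+ 2)%:E <= (6 * t ^+ 2)%:E)%E.
Proof.
move=> gauss xid t0 mut.
have [s lawE] := gauss _ xid.
have mxi : measurable_fun setT (xi : borel E -> measurableTypeR R).
  by apply: continuous_borel_measurable; case: xid.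
have mA : measurable [set y : R | t < `|y|].
  by apply: measurable_gt; exact: normr_measurable.
have msq : measurable_fun [set: R] (fun x : R => (x ^+ 2)%:E).
  by apply/measurable_EFinP; exact: measurable_funX.
have := lawE _ mA; rewrite -[xi @^-1` _]/[set x | t < `|xi x|] => muA.
rewrite muA in mut.
have pushE : (\int[mu]_x (xi x ^+ 2)%:E =
    \int[pushforward mu (xi : borel E -> measurableTypeR R)]_y (y ^+ 2)%:E)%E.
  by rewrite ge0_integral_pushforward// => y _; rewrite lee_fin sqr_ge0.
move: mut lawE; rewrite pushE /centered_normal_law.
have [_ _ lawE|s0 mut lawE] := eqVneq s 0.
  rewrite (eq_measure_integral (\d_(0 : measurableTypeR R)))//; last first.
    by move=> A mA' _; exact: lawE.
  by rewrite integral_dirac// expr0n mule0 lee_fin mulr_ge0// sqr_ge0.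
rewrite (eq_measure_integral (normal_prob 0 s))//; last first.
  by move=> A mA' _; exact: lawE.
apply: le_trans (normal_prob_second_moment s0) _.
rewrite lee_fin ler_wpM2l// -(real_normK (num_real s)) ler_sqr// leNgt.
apply/negP => /(normal_prob_tail s0); rewrite leNgt => /negP; exact.
Qed.

End normal_second_moment.

(** * The reproducing kernel Hilbert space *)

Lemma measurable_borel_set1 (R : realType) (E : normedModType R) (y : E) :
  measurable ([set y] : set (borel E)).
Proof.
rewrite -(setCK [set y]); apply: measurableC; apply: sub_sigma_algebra.
apply: closed_openC; apply: accessible_closed_set1.
exact: (hausdorff_accessible (@norm_hausdorff _ E)).
Qed.

Section seminorm_continuity.
Context (R : realType) (E : normedModType R) (q : E -> R).
Hypotheses (qS : is_seminorm q) (q1 : forall x, q x <= `|x|).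

Lemma seminorm_continuous : continuous q.
Proof.
move=> x; apply/cvgrPdist_le => e e0; near=> y.
have xy : `|x - y| <= e by near: y; exact: cvgr_dist_le.
have := q1 (x - y); have := seminorm_leD qS x y; have := seminorm_leD qS y x.
rewrite (seminormB qS y x) => h1 h2 h3; rewrite ler_norml; lra.
Unshelve. all: by end_near. Qed.

End seminorm_continuity.

Lemma linear_le_norm_continuous (R : realType) (E : normedModType R)
    (xi : {linear E -> R^o}) : (forall x, `|xi x| <= `|x|) ->
  continuous (xi : E -> R).
Proof.
move=> xi1 x; apply/cvgrPdist_le => e e0; near=> y.
have xy : `|x - y| <= e by near: y; exact: cvgr_dist_le.
by rewrite -(raddfB xi); exact: le_trans (xi1 _) xy.
Unshelve. all: by end_near. Qed.

(** * Continuous functionals and the Bochner integral *)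

Section bochner_dual.
Context d (T : measurableType d) (R : realType) (E : normedModType R).
Context (mu : probability T R).
Implicit Types (s f : T -> E).

Lemma simple_fun_measurable_fiber s (y : E) : simple_fun s ->
  measurable (s @^-1` [set y]).
Proof.
move=> [ms _]; rewrite -[X in measurable X]setTI.
by apply: (ms measurableT); exact: measurable_borel_set1.
Qed.

(** On each of the finitely many fibres of [s] the function is the norm of [f] minus a constant.
    Joint measurability of subtraction, which can fail in a nonseparable space, is thus avoided. *)
Lemma measurable_norm_sub_simple f s : measurable_fun setT (f : T -> borel E) ->
  simple_fun s -> measurable_fun setT (fun x => `|f x - s x|).
Proof.
move=> mf sS _ A mA; rewrite setTI.
have -> : (fun x => `|f x - s x|) @^-1` A = \bigcup_(y in range s)
    (s @^-1` [set y] `&` f @^-1` [set z | A `|z - y|]).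
  apply/seteqP; split=> [x Ax|x [_ [z _ <-]] [/= -> //]].
  by exists (s x) => //; split.
apply: fin_bigcup_measurable => [|y _]; first by case: sS.
apply: measurableI; first exact: simple_fun_measurable_fiber.
rewrite -[X in measurable X]setTI; apply: (mf measurableT).
have mn : measurable_fun setT ((fun z => `|z - y|) : borel E -> R).
  apply: continuous_borel_measurable => z; apply: cvg_norm.
  by apply: cvgB; [exact: cvg_id | exact: cvg_cst].
by have := mn measurableT _ mA; rewrite setTI.
Qed.

Variable xi : {linear E -> R^o}.
Hypothesis xi1 : forall x, `|xi x| <= `|x|.

Let measurable_xi f : measurable_fun setT (f : T -> borel E) ->
  measurable_fun setT (fun x => xi (f x) : R).
Proof.
move=> mf; apply: (@measurableT_comp _ _ _ T (borel E) R (xi : borel E -> R)) => //.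
by apply: continuous_borel_measurable; exact: linear_le_norm_continuous.
Qed.

Lemma simple_integral_dual s : simple_fun s ->
  mu.-integrable setT (fun x => (xi (s x) : R)%:E) /\
  (\int[mu]_x (xi (s x) : R)%:E = (xi (simple_integral mu s) : R)%:E)%E.
Proof.
move=> sS; have [ms sfin] := sS.
pose D := finmap.enum_fset (fset_set (range s)).
have mfib y := simple_fun_measurable_fiber y sS.
pose F (y : E) (x : T) : \bar R := ((xi y : R)%:E * (\1_(s @^-1` [set y]) x)%:E)%E.
have iF y : mu.-integrable setT (F y).
  by apply: integrableZl => //; exact: integrable_indic.
have xiE : (fun x => (xi (s x) : R)%:E) = (fun x => \sum_(y <- D) F y x)%E.
  apply/funext => x; have sD : s x \in D by rewrite in_fset_set// inE; exists x.
  rewrite (bigD1_seq (s x)) ?finmap.fset_uniq//= {1}/F indicE mem_set// mule1.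
  rewrite big1 ?adde0// => y ysx; rewrite /F indicE memNset ?mule0//.
  by move=> /= sxy; rewrite sxy eqxx in ysx.
rewrite xiE; split; first by apply: integrable_sum.
rewrite integral_sum// /simple_integral fsbig_finite//= linear_sum.
rewrite -sumEFin; apply: eq_bigr => y _.
rewrite integralZl//; last exact: integrable_indic.
rewrite integral_indic// setIT linearZ_LR /GRing.scale /= mulrC EFinM fineK//.
exact: fin_num_measure.
Qed.

(** Both sides are compared with their analogues for [s n]: since [|xi x| <= |x|], the errors are at
    most the integral of [|f x - s n x|] and the distance from [h] to the integral of [s n]. *)
Lemma is_bochner_integral_dual f h : is_bochner_integral mu f h ->
  mu.-integrable setT (fun x => (xi (f x) : R)%:E) /\
  (\int[mu]_x (xi (f x) : R)%:E = (xi h : R)%:E)%E.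
Proof.
move=> [mf [s [sS /fine_cvgP[sfin s0] sh]]].
have near_s (e : R) : 0 < e -> exists n,
    (\int[mu]_x (`|f x - s n x|)%:E <= e%:E)%E /\
    `|h - simple_integral mu (s n)| <= e.
  move=> e0; near \oo => n; exists n; split.
    rewrite -[leLHS]fineK; last by near: n.
    rewrite lee_fin; apply: le_trans (ler_norm _) _.
    rewrite -normrN -sub0r; near: n.
    by move/cvgrPdist_le : s0 => /(_ _ e0).
  by near: n; move/cvgrPdist_le : sh => /(_ _ e0).
have mxf := measurable_xi mf.
have [n1 [n1P _]] := near_s 1 ltr01.
have mns n : measurable_fun setT (fun x => (`|f x - s n x|)%:E).
  by apply/measurable_EFinP; exact: measurable_norm_sub_simple.
have ins n (e : R) : (\int[mu]_x (`|f x - s n x|)%:E <= e%:E)%E ->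
    mu.-integrable setT (fun x => (`|f x - s n x|)%:E).
  move=> ne; apply/integrableP; split; first exact: mns.
  under eq_integral do rewrite /= normr_id.
  exact: le_lt_trans ne (ltry _).
have ixf : mu.-integrable setT (fun x => (xi (f x) : R)%:E).
  have [isn _] := simple_integral_dual (sS n1).
  apply: (le_integrable measurableT _ _
    (integrableD measurableT (ins _ _ n1P) (integrable_abse isn))).
    exact/measurable_EFinP.
  move=> x _ /=; rewrite lee_fin [leRHS]ger0_norm ?addr_ge0//.
  rewrite -lerBlDr (le_trans (lerB_dist _ _))// -(raddfB xi).
  exact: xi1.
split=> //.
have fin : (\int[mu]_x (xi (f x) : R)%:E)%E \is a fin_num.
  exact: integrable_fin_num ixf.
rewrite -(fineK fin); congr EFin; set I := fine _.
apply/eqP; rewrite -subr_eq0 -normr_le0; apply/ler_addgt0Pl => e e0.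
rewrite addr0.
have [n [nf nh]] := near_s _ (divr_gt0 e0 (ltr0Sn R 1)).
have [isn isnE] := simple_integral_dual (sS n).
rewrite (le_trans (ler_distD (xi (simple_integral mu (s n))) _ _))//.
rewrite (splitr e) lerD//; last first.
  by rewrite distrC -(raddfB xi); exact: le_trans (xi1 _) nh.
rewrite -lee_fin -abse_EFin EFinB -isnE /I fineK//.
rewrite -integralB_EFin//; apply: le_trans nf.
apply: le_trans (le_abse_integral _ _ _) _ => //.
  exact: measurable_int (integrableB measurableT ixf isn).
apply: ge0_le_integral => //.
- apply: measurableT_comp => //.
  exact: measurable_int (integrableB measurableT ixf isn).
- move=> x _; rewrite -EFinB /= lee_fin -(raddfB xi); exact: xi1.
Unshelve. all: by end_near. Qed.

End bochner_dual.

Section rkhs_bound.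
Context (R : realType) (E : normedModType R) (mu : probability (borel E) R).
Hypothesis gauss_mu : centered_gaussian mu.

(** The witness is the very function that [xget] picks in [rkhs_dot]; membership of [h] in the RKHS
    makes it a genuine representative. *)
Lemma rkhs_norm_sqr h : rkhs mu h -> exists2 g, rkhs_repr mu h g &
  (\int[mu]_x (g x ^+ 2)%:E = (rkhs_norm mu h ^+ 2)%:E)%E.
Proof.
move=> [g0 hg0]; pose g := xget (cst 0) (rkhs_repr mu h).
have hg : rkhs_repr mu h g by exact: (xgetPex _ (ex_intro _ g0 hg0)).
exists g => //; have [[gL2 _] _] := hg.
have ig := Lfun2_integrable_sqr gL2.
have ig0 : (0 <= \int[mu]_x (g x ^+ 2)%:E)%E.
  by apply: integral_ge0 => x _; rewrite lee_fin sqr_ge0.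
have fin := integrable_fin_num measurableT ig.
rewrite /rkhs_norm sqr_sqrtr; last by apply: fine_ge0.
by rewrite /rkhs_dot /Rintegral fineK.
Qed.

(* By Hahn-Banach [q h] is the value at [h] of a functional [xi <= q], whose
   variance is controlled by the tail of [q] under [mu]. *)
Lemma rkhs_seminorm_le (q : E -> R) (t : R) h :
  is_seminorm q -> (forall x, q x <= `|x|) -> 0 < t ->
  (mu [set x | (t < q x)%R] < (normal_tail R)%:E)%E ->
  rkhs mu h -> q h <= t * (3 + rkhs_norm mu h ^+ 2).
Proof.
move=> qS q1 t0 mut /rkhs_norm_sqr[g [[gL2 _] hint] gE].
have [xi0 [xilin xiq xih]] := hahn_banach_seminorm qS h.
pose xiM := GRing.isLinear.Build R E R^o *:%R xi0 xilin.
pose xi : {linear E -> R^o} := HB.pack xi0 xiM.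
have xiZ a x : xi0 (a *: x) = a * xi0 x := linearZ_LR xi a x.
have absxi x : `|xi x| <= q x.
  rewrite ler_norml xiq andbT lerNl -(raddfN xi) -(seminormN qS).
  exact: xiq.
have xi1 x : `|xi x| <= `|x| := le_trans (absxi x) (q1 x).
have cxi := linear_le_norm_continuous xi1.
have mxi : measurable_fun setT (xi : borel E -> R) :=
  continuous_borel_measurable cxi.
have mq : measurable_fun setT (q : borel E -> R).
  by apply: continuous_borel_measurable; exact: seminorm_continuous.
(* As [|xi| <= q], the tail of [xi] beyond [t] is no heavier than that of [q]. *)
have xi2 : (\int[mu]_x ((xi x : R) ^+ 2)%:E <= (6 * t ^+ 2)%:E)%E.
  apply: centered_gaussian_second_moment => //; first exact: ltW.
  apply: le_lt_trans mut; apply: le_measure; rewrite ?inE.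
  - by apply: measurable_gt; exact: measurableT_comp.
  - exact: measurable_gt.
  - by move=> x /= /lt_le_trans; apply.
have ixi2 : mu.-integrable setT (fun x => ((xi x : R) ^+ 2)%:E).
  apply/integrableP; split; first by apply/measurable_EFinP; exact: measurable_funX.
  under eq_integral do rewrite /= ger0_norm ?sqr_ge0//.
  exact: le_lt_trans xi2 (ltry _).
have ig2 := Lfun2_integrable_sqr gL2.
have [ixg xigE] := is_bochner_integral_dual xi1 hint.
(* Young's inequality [g * xi <= xi ^+ 2 / (2 * t) + t * g ^+ 2 / 2], weighted so that the second
   moment [6 * t ^+ 2] contributes [3 * t]. *)
have i1 := integrableZl measurableT (2 * t)^-1 ixi2.
have i2 := integrableZl measurableT (t / 2) ig2.
rewrite -xih -lee_fin -[xi0 h]/(xi h : R) -xigE.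
apply: le_trans (le_integral measurableT ixg (integrableD measurableT i1 i2) _) _.
  move=> x _; rewrite /= -!EFinM -EFinD lee_fin xiZ -subr_ge0.
  have -> : (2 * t)^-1 * xi0 x ^+ 2 + t / 2 * g x ^+ 2 - g x * xi0 x =
      (2 * t)^-1 * (xi0 x - t * g x) ^+ 2 by field; rewrite gt_eqF.
  by rewrite mulr_ge0 ?sqr_ge0// invr_ge0 mulr_ge0// ltW.
rewrite integralD// integralZl// integralZl//= gE.
apply: (@le_trans _ _ ((2 * t)^-1%:E * (6 * t ^+ 2)%:E +
    (t / 2 * rkhs_norm mu h ^+ 2)%:E)%E).
  by rewrite EFinM leeD2r// lee_wpmul2l// lee_fin invr_ge0 mulr_ge0// ltW.
rewrite -EFinM -EFinD lee_fin.
have -> : (2 * t)^-1 * (6 * t ^+ 2) = 3 * t by field; rewrite gt_eqF.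
have : 0 <= t * rkhs_norm mu h ^+ 2 by rewrite mulr_ge0 ?sqr_ge0// ltW.
lra.
Qed.

End rkhs_bound.

(** * Full measure *)

Lemma separable_dense_seq (R : realType) (E : normedModType R) :
  separable E -> exists d : nat -> E, dense (range d).
Proof.
move=> [D /countable_injP[f finj] dD].
(* The [n]-th term is the point of [D] with code [n] under [f], and 0 when no point has this
   code. *)
exists (fun n => xget 0 [set x | D x /\ f x = n]) => O O0 oO.
have [x [Ox Dx]] := dD O O0 oO; exists x; split=> //; exists (f x) => //=.
case: xgetP => [y -> [Dy fyx]|/(_ x)]; last by case.
by apply: finj; rewrite ?inE.
Qed.

(** Continuity from above. The conclusion covers all later indices so that [n] may afterwards be
    enlarged. *)
Lemma nonincreasing_probability_small d (T : measurableType d) (R : realType)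
    (mu : probability T R) (A : nat -> set T) (e : R) :
  (forall n, measurable (A n)) -> (forall m n, (m <= n)%N -> A n `<=` A m) ->
  \bigcap_n A n = set0 -> 0 < e ->
  exists n, forall k, (n <= k)%N -> (mu (A k) < e%:E)%E.
Proof.
move=> mA decA A0 e0.
have : mu \o A @ \oo --> mu (\bigcap_n A n).
  apply: nonincreasing_cvg_mu => //.
  - exact: le_lt_trans (probability_le1 _ _) (ltry _).
  - exact: bigcapT_measurable.
  - by move=> m n /decA; rewrite -subsetEset.
rewrite A0 measure0 => /fine_cvgP[_] /cvgrPdist_lt/(_ _ e0)[n _ hn].
exists n => k /hn /=; rewrite sub0r normrN => hk.
rewrite -(fineK (fin_num_measure mu _ (mA k))) lte_fin.
exact: le_lt_trans (ler_norm _) hk.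
Qed.

Lemma geometric_small (R : realType) (C e : R) : 0 < e ->
  exists n, forall k, (n <= k)%N -> 2^-1 ^+ k * C <= e.
Proof.
move=> e0; exists (Num.truncn (C / e)) => k nk.
rewrite exprVn mulrC ler_pdivrMr ?exprn_gt0// mulrC -ler_pdivrMr//.
apply: le_trans (ltW (truncnS_gt _)) _.
rewrite -natrX ler_nat; apply: leq_trans (ltn_expl k (isT : 1 < 2)%N).
by rewrite ltnS.
Qed.

(** Partial sums of [m0]. Indices chosen independently for each [k] are thereby enlarged so as to
    make the spans nested. *)
Lemma nondecreasing_majorant (m0 : nat -> nat) : exists m : nat -> nat,
  {homo m : i j / (i <= j)%N} /\ forall k, (m0 k <= m k)%N.
Proof.
exists (fun k => \sum_(i < k.+1) m0 i)%N; split=> [|k].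
  apply: homo_leq => [//|j i k|k]; first exact: leq_trans.
  by rewrite [leqRHS]big_ord_recr leq_addr.
by rewrite big_ord_recr leq_addl.
Qed.

Section vanishing_measure.
Context (R : realType) (E : completeNormedModType R) (r : seminorm_seq E).
Hypothesis mr : forall k, measurable_fun setT (r k : borel E -> R).

Lemma vanishing_setE : [set x | x \in vanishing r] =
  \bigcap_i \bigcup_n \bigcap_k
    [set x | (n <= k)%N -> r k x <= i.+1%:R^-1].
Proof.
apply/seteqP; split=> x /=.
  move=> /vanishingP xv i _; have [|n hn] := xv i.+1%:R^-1.
    by rewrite invr_gt0.
  by exists n => // k _ /=; exact: hn.
move=> xv; apply/vanishingP => e e0.
have [n _ hn] := xv (Num.truncn e^-1) I; exists n => k nk.
apply: le_trans (hn k I nk) _.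
rewrite -[leRHS]invrK lef_pV2 ?posrE ?invr_gt0//.
exact/ltW/truncnS_gt.
Qed.

Lemma measurable_vanishing :
  measurable ([set x | x \in vanishing r] : set (borel E)).
Proof.
rewrite vanishing_setE; apply: bigcapT_measurable => i.
apply: bigcupT_measurable => n; apply: bigcapT_measurable => k.
have [nk|nk] := leqP n k; last first.
  by rewrite (_ : [set x | _] = setT) //; apply/seteqP; split.
rewrite (_ : [set x | _] = ~` [set x | i.+1%:R^-1 < r k x]).
  by apply: measurableC; exact: (measurable_gt _ (mr k)).
apply/seteqP; split=> x /=; first by move=> /(_ isT) rx; apply/negP; rewrite -leNgt.
by move=> /negP; rewrite -leNgt.
Qed.

(** By Borel-Cantelli almost every [x] lies in only finitely many of these sets, and then
    [r k x <= 2^-1 ^+ k] for all large [k]. *)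
Lemma probability_vanishing (mu : probability (borel E) R) :
  (forall k,
    (mu [set x | (2^-1 ^+ k < r k x)%R] <= (1 / (2 ^ k.+1)%:R)%:E)%E) ->
  mu [set x | x \in vanishing r] = 1%E.
Proof.
move=> rk; pose A k : set (borel E) := [set x | 2^-1 ^+ k < r k x].
have mA k : measurable (A k) by exact: measurable_gt.
have limA : mu (lim_sup_set A) = 0%E.
  apply: lim_sup_set_cvg0 => //.
  apply: (@le_lt_trans _ _ (\sum_(k <oo) (1 / (2 ^ k.+1)%:R)%:E)%E).
    by apply: lee_nneseries => // k _; exact: rk.
  exact: le_lt_trans (epsilon_trick0 xpredT ler01) (ltry _).
have mlim : measurable (lim_sup_set A).
  by apply: bigcapT_measurable => n; apply: bigcup_measurable.
have sub : ~` lim_sup_set A `<=` [set x | x \in vanishing r].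
  move=> x /= /existsNP[n /not_implyP[_ nx]]; apply/vanishingP => e e0.
  have [n' hn'] := geometric_small 1 e0; exists (maxn n n') => k.
  rewrite geq_max => /andP[nk /hn']; rewrite mulr1; apply: le_trans.
  by rewrite leNgt; apply/negP => xk; apply: nx; exists k.
have mV := measurable_vanishing.
apply/eqP; rewrite eq_le probability_le1//=.
have <- : mu (~` lim_sup_set A) = 1%E by rewrite probability_setC// limA sube0.
by apply: le_measure; rewrite ?inE//; exact: measurableC.
Qed.

End vanishing_measure.

(** * Choice of the spans and verification of the properties *)

Theorem theorem1p1 (R : realType) (E : completeNormedModType R)
    (sepE : separable E) (mu : probability (borel E) R)
    (gauss_mu : centered_gaussian mu) :
  exists F : banach_subspace E,
    [/\ separable F,
        rkhs mu `<=` bsub_set F,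
        measurable (bsub_set F : set (borel E)),
        mu (bsub_set F) = 1%E &
        rkhs_embedding_compact mu F /\ bsub_embedding_compact F].
Proof.
have [d dd] := separable_dense_seq sepE.
pose q n := set_dist (seq_span d n).
have qlin n := seq_span_lin d n.
have span0 n : seq_span d n !=set0 by exists 0; case: (qlin n).
have qS n : is_seminorm (q n) := set_dist_seminorm (qlin n).
have q1 n x : q n x <= `|x| := set_dist_norm (qlin n) x.
have mq n : measurable_fun setT (q n : borel E -> R).
  by apply: continuous_borel_measurable; exact: (seminorm_continuous (qS n) (q1 n)).
have p0 := normal_tail_gt0 R; set p := normal_tail R in p0.
have qtail (t e : R) : 0 < t -> 0 < e -> exists n, forall k, (n <= k)%N ->
    (mu [set x | (t < q k x)%R] < e%:E)%E.
  move=> t0; apply: nonincreasing_probability_small.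
  - by move=> n; exact: measurable_gt.
  - move=> i j ij x /= /lt_le_trans; apply.
    by apply: set_distS => //; exact: seq_spanS.
  - apply/seteqP; split => // x xA.
    have [n nx] := seq_span_dist_small dd x t0.
    by have := lt_trans nx (xA n I); rewrite ltxx.
pose a k : R := Num.min p (1 / (2 ^ k.+1)%:R).
have a0 k : 0 < a k by rewrite lt_min p0 divr_gt0// ltr0n expn_gt0.
have b0 k : 0 < 4^-1 ^+ k :> R by rewrite exprn_gt0// invr_gt0.
have /choice[m0 m0P] k := qtail _ _ (b0 k) (a0 k).
have [m [m_homo m0m]] := nondecreasing_majorant m0.
have mP k : (mu [set x | (4^-1 ^+ k < q (m k) x)%R] < (a k)%:E)%E.
  exact: m0P.
pose r := dist_seq d m.
have rE k x : r k x = 2 ^+ k * q (m k) x by [].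
(* The threshold [4^-1 ^+ k] outweighs the weight [2 ^+ k]; the remaining [2^-1 ^+ k] tends to 0,
   both in the almost sure estimate and in the one on the RKHS. *)
have pow24 k : 2 ^+ k * 4^-1 ^+ k = 2^-1 ^+ k :> R.
  by rewrite -exprMn; congr (_ ^+ _); field.
have mr k : measurable_fun setT (r k : borel E -> R).
  by apply: measurable_funM => //; exact: mq.
have rkhs_r h k : rkhs mu h -> r k h <= 2^-1 ^+ k * (3 + rkhs_norm mu h ^+ 2).
  move=> hH; rewrite rE -pow24 -mulrA ler_wpM2l ?exprn_ge0//.
  apply: (rkhs_seminorm_le gauss_mu (qS (m k)) (q1 (m k)) (b0 k) _ hH).
  by apply: lt_le_trans (mP k) _; rewrite lee_fin ge_min lexx.
(* With this [T], [rkhs_seminorm_le] applied to the norm of [E] itself bounds the balls of the RKHS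
   in [E]. *)
have [T T0 muT] : exists2 T : R, 0 < T & (mu [set x | (T < `|x|)%R] < p%:E)%E.
  pose A n : set (borel E) := [set x | n.+1%:R < `|x|].
  have [||||n hn] := @nonincreasing_probability_small _ _ _ mu A p.
  - move=> n; apply: measurable_gt; apply: continuous_borel_measurable.
    exact: norm_continuous.
  - by move=> i j ij x /=; apply: le_lt_trans; rewrite ler_nat ltnS.
  - apply/seteqP; split => // x /(_ (Num.truncn `|x|) I) /=.
    by move=> /ltW; rewrite leNgt truncnS_gt.
  - by [].
  - by exists n.+1%:R => //; exact: hn.
exists (vanishing_subspace r); rewrite vanishing_subspaceE; split.
- exact: dist_seq_separable.
- move=> h hH; apply/vanishingP => e e0.
  have [n hn] := geometric_small (3 + rkhs_norm mu h ^+ 2) e0.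
  by exists n => k /hn; apply: le_trans; exact: rkhs_r.
- exact: measurable_vanishing.
- apply: probability_vanishing => // k.
  have -> : [set x | 2^-1 ^+ k < r k x] = [set x | 4^-1 ^+ k < q (m k) x].
    by apply: eq_set => x; rewrite rE -pow24 ltr_pM2l ?exprn_gt0.
  by apply: ltW; apply: lt_le_trans (mP k) _; rewrite lee_fin ge_min lexx orbT.
- split; last exact: dist_seq_embedding_compact.
  move=> B [BH [M BM]].
  (* A point of [B] forces [M] to be nonnegative, so that squaring preserves the bound. *)
  have normM h : B h -> 3 + rkhs_norm mu h ^+ 2 <= 3 + M ^+ 2.
    move=> Bh; rewrite lerD2l ler_sqr ?nnegrE ?sqrtr_ge0//; first exact: BM.
    exact: le_trans (sqrtr_ge0 _) (BM _ Bh).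
  have M0 : 0 <= 3 + M ^+ 2 by rewrite addr_ge0// sqr_ge0.
  apply: (dist_seq_precompact m_homo (M := T * (3 + M ^+ 2))).
  + move=> h Bh; have hH := BH _ Bh.
    apply: le_trans (rkhs_seminorm_le gauss_mu _ (fun x => lexx `|x|) T0 muT hH) _.
      by split=> [x y|c x]; [exact: ler_normD | exact: normrZ].
    by rewrite ler_wpM2l ?(ltW T0)//; exact: normM.
  (* The bound [rkhs_r] depends on [h] only through its RKHS norm, so the tails are uniformly small
     on [B]. *)
  + move=> e e0; have [n hn] := geometric_small (3 + M ^+ 2) e0.
    exists n => h Bh j /hn; apply: le_trans.
    apply: le_trans (rkhs_r _ _ (BH _ Bh)) _.
    by rewrite ler_wpM2l ?exprn_ge0 ?invr_ge0//; exact: normM.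
Qed.
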